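(* Let $K\in C^0(\mathbb{R})$ with $\|K\|_{C^0(\mathbb{R})}=\sup_{\mathbb{R}}|K|<\frac{\pi}{4}$ and define $u:\mathbb{R}^2\to\mathbb{R}^2$ by $$u(x,y):=\int_0^xe^{iK(t)}\,dt+i\int_0^ye^{iK(s)}\,ds ,$$ where $\mathbb{R}^2$ is identified with $\mathbb{C}$ in the target. Then $u$ is a $C^1(\mathbb{R}^2)^2$ local diffeomorphism and is an everywhere solution on $\mathbb{R}^2$ of the PDE system $$Du\,D\Big(\tfrac12|Du|^2\Big)+|Du|^2[Du]^\perp\,\mathrm{Div}(Du)=0 .$$
   Context: $Du$ is the $2\times2$ gradient matrix of $u$, $|Du|$ its Euclidean (Frobenius) norm, and $[Du(x,y)]^\perp$ the orthogonal projection of $\mathbb{R}^2$ on the null space of $Du(x,y)^\top$. Since $u$ need not be twice differentiable, ''everywhere solution'' is understood for the system in this contracted form: $|Du|^2$ is everywhere differentiable and its classical gradient $D(\frac12|Du|^2)$ is used in the first term; the second term is understood as zero where its coefficient $|Du|^2[Du]^\perp$ vanishes identically on $\mathbb{R}^2$ (irrespective of whether $\mathrm{Div}(Du)$ exists classically). *)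

(* Defs.v *)
From HB Require Import structures.
From mathcomp Require Import all_boot all_order all_algebra.
From mathcomp Require Import all_classical all_reals all_analysis.
From mathcomp Require Import complex.

Set Implicit Arguments.
Unset Strict Implicit.
Unset Printing Implicit Defensive.

Import Order.TTheory GRing.Theory Num.Theory.
Import numFieldNormedType.Exports.
Local Open Scope classical_set_scope.
Local Open Scope ring_scope.
Local Open Scope complex_scope.

(* Points (x, y) of R^2 are row vectors, as 'J requires; matrices act on
   column vectors. *)

(* 'J f p acts on row vectors from the right, so the gradient matrix
   (Du)_{a i} = D_i u_a is its transpose. *)
Definition Dmat (R : realType) (u : 'rV[R]_2 -> 'rV[R]_2) (p : 'rV[R]_2)
  : 'M[R]_2 := ('J u p)^T.

Definition grad (R : realType) (f : 'rV[R]_2 -> R) (p : 'rV[R]_2)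
  : 'cV[R]_2 := \col_i 'D_(delta_mx 0 i) f p.

(* The library norm `|A| on matrices is the sup norm, hence this definition. *)
Definition frob (R : realType) (A : 'M[R]_2) : R :=
  Num.sqrt (\sum_i \sum_j A i j ^+ 2).

(* kermx A is a row space, {w | w *m A = 0}: its transposes are the column
   vectors v with A^T *m v = 0.  Likewise kermx (kermx A)^T is its orthogonal
   complement.  proj_mx also acts on rows, whence the outer transpose; see
   perp_proj_ker and perp_proj_orth. *)
Definition perp_proj (R : realType) (A : 'M[R]_2) : 'M[R]_2 :=
  (proj_mx (kermx A) (kermx (kermx A)^T))^T.

Lemma kermx_cap_orth (R : realType) (A : 'M[R]_2) :
  (kermx A :&: kermx (kermx A)^T = 0)%MS.
Proof.
apply/eqP/rowV0P => v; rewrite sub_capmx => /andP[/submxP[w vE]] vk.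
have {}vk : v *m v^T = 0 by rewrite {2}vE trmx_mul mulmxA (sub_kermxP vk) mul0mx.
move/matrixP/(_ 0 0): vk; rewrite !mxE => /eqP.
rewrite psumr_eq0; last by move=> i _; rewrite mxE -expr2 sqr_ge0.
move=> /allP v0; apply/rowP => i; rewrite mxE; apply/eqP.
by have := v0 i (mem_index_enum _); rewrite /= mxE -expr2 sqrf_eq0.
Qed.

Lemma perp_proj_ker (R : realType) (A : 'M[R]_2) (v : 'cV[R]_2) :
  A^T *m (perp_proj A *m v) = 0.
Proof.
apply: trmx_inj; rewrite trmx0 !trmx_mul !trmxK.
apply/sub_kermxP; exact: proj_mx_sub.
Qed.

Lemma perp_proj_orth (R : realType) (A : 'M[R]_2) (v w : 'cV[R]_2) :
  A^T *m w = 0 -> (v - perp_proj A *m v)^T *m w = 0.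
Proof.
move=> Aw; have wk : (w^T <= kermx A)%MS.
  by apply/sub_kermxP; rewrite -[A]trmxK -trmx_mul Aw trmx0.
have full : (v^T <= kermx A + kermx (kermx A)^T)%MS.
  apply: submx_full; rewrite /row_full mxrank_disjoint_sum ?kermx_cap_orth //.
  by rewrite [X in (_ + X)%N]mxrank_ker mxrank_tr subnKC ?rank_leq_row.
have orthk : ((v - perp_proj A *m v)^T <= kermx (kermx A)^T)%MS.
  by rewrite linearB /= trmx_mul trmxK proj_mx_compl_sub.
case/submxP: wk => c /(congr1 trmx); rewrite trmxK trmx_mul => ->.
by rewrite mulmxA (sub_kermxP orthk) mul0mx.
Qed.

(* D_1(D_1 u) + D_2(D_2 u), the row-wise divergence of Du. *)
Definition Div_D (R : realType) (u : 'rV[R]_2 -> 'rV[R]_2) (p : 'rV[R]_2)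
  : 'cV[R]_2 :=
  \col_a \sum_i 'D_(delta_mx 0 i) (fun q => Dmat u q a i) p.

Definition Div_D_exists (R : realType) (u : 'rV[R]_2 -> 'rV[R]_2)
    (p : 'rV[R]_2) : Prop :=
  forall a i : 'I_2, derivable (fun q => Dmat u q a i) p (delta_mx 0 i).

Definition perp_coef (R : realType) (u : 'rV[R]_2 -> 'rV[R]_2) (p : 'rV[R]_2)
  : 'M[R]_2 := frob (Dmat u p) ^+ 2 *: perp_proj (Dmat u p).

(* |Du|^2 [Du]^perp Div(Du), read as 0 if |Du|^2 [Du]^perp is identically 0. *)
Definition perp_term (R : realType) (u : 'rV[R]_2 -> 'rV[R]_2) (p : 'rV[R]_2)
  : 'cV[R]_2 :=
  if `[< forall q, perp_coef u q = 0 >] then 0 else perp_coef u p *m Div_D u p.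

Definition half_sqnorm_D (R : realType) (u : 'rV[R]_2 -> 'rV[R]_2)
  (p : 'rV[R]_2) : R := 2^-1 * frob (Dmat u p) ^+ 2.

(* 'D_ and 'd are total functions, so the existence of every derivative that
   occurs is required explicitly. *)
Definition everywhere_solution (R : realType) (u : 'rV[R]_2 -> 'rV[R]_2)
  : Prop :=
  [/\ forall p, differentiable u p,
      forall p, differentiable (half_sqnorm_D u) p,
      ~ (forall p, perp_coef u p = 0) -> forall p, Div_D_exists u p
    & forall p, Dmat u p *m grad (half_sqnorm_D u) p + perp_term u p = 0].

Definition C1_on (R : realType) (U : set 'rV[R]_2)
    (f : 'rV[R]_2 -> 'rV[R]_2) : Prop :=
  [/\ open U, forall p, U p -> differentiable f p
    & forall p, U p -> {for p, continuous (Dmat f)}].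

Definition C1_local_diffeo (R : realType) (f : 'rV[R]_2 -> 'rV[R]_2) : Prop :=
  forall p, exists (U V : set 'rV[R]_2) (g : 'rV[R]_2 -> 'rV[R]_2),
    [/\ U p, f @` U = V, {in U, cancel f g}, C1_on U f & C1_on V g].

Definition oriented_integral (R : realType) (f : R -> R) (a b : R) : R :=
  if a <= b then \int[@lebesgue_measure R]_(t in `[a, b]) f t
  else - \int[@lebesgue_measure R]_(t in `[b, a]) f t.

Definition complex_integral (R : realType) (f : R -> R[i]) (a b : R) : R[i] :=
  oriented_integral (fun t => complex.Re (f t)) a b
  +i* oriented_integral (fun t => complex.Im (f t)) a b.

Definition expi (R : realType) (t : R) : R[i] := cos t +i* sin t.

Definition row_of_complex (R : realType) (z : R[i]) : 'rV[R]_2 :=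
  \row_i (if i == 0 then complex.Re z else complex.Im z).

Definition u_of (R : realType) (K : R -> R) (p : 'rV[R]_2) : 'rV[R]_2 :=
  row_of_complex
    (complex_integral (fun t => expi (K t)) 0 (p 0 0)
     + 'i * complex_integral (fun s => expi (K s)) 0 (p 0 1)).

(* Main.v *)
(* Write F and G for the primitives of cos K and sin K vanishing at 0, so that
   u = (F(x) - G(y), G(x) + F(y)) and Du has columns (cos K(x), sin K(x)) and
   (- sin K(y), cos K(y)).  Hence |Du|^2 = 2 is constant and
   det Du = cos (K(x) - K(y)) > 0: both coefficients of the system vanish.
   If c = sup |K| < pi/4, then id - u is Lipschitz in the sup norm with constant
   1 - cos c + sin c < 1.  By Banach's fixed point theorem u is therefore a
   bijection of the plane with Lipschitz inverse, and a Lipschitz inverse of a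
   C^1 map with invertible differentials is C^1. *)
From HB Require Import structures.
Require Import Defs.
From mathcomp Require Import all_boot all_order all_algebra.
From mathcomp Require Import all_classical all_reals all_analysis.
From mathcomp Require Import ring lra.
Import Order.TTheory GRing.Theory Num.Theory.
Import numFieldNormedType.Exports.
Local Open Scope classical_set_scope.
Local Open Scope ring_scope.

Set Implicit Arguments.
Unset Strict Implicit.

(** * Primitives of continuous functions and the mean value inequality *)

Lemma is_derive_oriented_integral (R : realType) (f : R -> R) :
  continuous f ->
  forall x : R, is_derive x 1 (fun y => oriented_integral f 0 y) (f x).
Proof.
move=> fc x.
(* A base point strictly to the left of both 0 and [x]: near [x] the oriented integral is then
   [F y - F 0] whatever the sign of [y], and [x] is interior to the interval where the fundamental
   theorem is applied. *)
pose a := Num.min 0 x - 1.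
have a0 : a < 0 by rewrite /a ltrBlDr gt_min add0r ltr01.
have ax : a < x by rewrite /a ltrBlDr gt_min ltrDl ltr01 orbT.
have fint b c : lebesgue_measure.-integrable `[b, c] (EFin \o f).
  apply: continuous_compact_integrable; first exact: segment_compact.
  exact: continuous_subspaceT.
pose F y := \int[@lebesgue_measure R]_(t in `[a, y]) f t.
have split_int b c : a <= b -> b <= c ->
    \int[@lebesgue_measure R]_(t in `[b, c]) f t = F c - F b.
  move=> ab bc; rewrite [RHS](@Rintegral_itvB _ f (BLeft a) (BRight c) b)//.
  rewrite Rintegral_itv_obnd_cbnd//.
  by apply: integrableS (fint b c) => //; apply: subset_itvr; rewrite bnd_simp.
have [dF F'x] := @continuous_FTC1_closed R f a x (x + 1)
  (ltr_pwDr ltr01 (lexx x)) (fint a (x + 1)) ax (fc x).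
have DF : is_derive x 1 (F - cst (F 0)) (f x).
  rewrite -[f x]subr0; apply: is_deriveB.
  by split; [exact: dF|rewrite -derive1E; exact: F'x].
apply: near_eq_is_derive DF.
near=> y.
have ay : a < y by near: y; exact: lt_nbhsr.
rewrite /oriented_integral !fctE; have [y0|y0] := leP 0 y.
  by rewrite split_int// ltW.
by rewrite split_int ?opprB// ltW.
Unshelve. all: by end_near. Qed.

Lemma bounded_derivative_lipschitz (R : realType) (f df : R -> R) (k : R) :
  (forall x : R, is_derive x 1 f (df x)) -> (forall x, `|df x| <= k) ->
  forall x y, `|f x - f y| <= k * `|x - y|.
Proof.
move=> fd dk; suff le x y : x <= y -> `|f y - f x| <= k * `|y - x|.
  move=> x y; have [/le|/ltW/le//] := leP x y.
  by rewrite distrC (distrC y).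
move=> xy; have [|z _ ->] := @MVT_segment R f df x y xy (fun z _ => fd z).
  apply: continuous_subspaceT => z; apply: differentiable_continuous.
  by apply/derivable1_diffP; case: (fd z).
by rewrite normrM ler_wpM2r.
Qed.

(** * Continuity and differentiability by coordinates *)

Lemma continuous_mxP (T : topologicalType) (R : numFieldType) (m n : nat)
    (f : T -> 'M[R]_(m, n)) (x : T) :
  (forall i j, {for x, continuous (fun t => f t i j)}) -> {for x, continuous f}.
Proof.
move=> fc; apply/cvg_ballP => e e0.
have fe : forall ij : 'I_m * 'I_n,
    \forall t \near x, ball (f x ij.1 ij.2) e (f t ij.1 ij.2).
  by move=> ij; have /cvg_ballP := fc ij.1 ij.2; exact.
near=> t.
split=> // i j.
suff : forall ij : 'I_m * 'I_n, ball (f x ij.1 ij.2) e (f t ij.1 ij.2).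
  by move=> /(_ (i, j)).
near: t; exact: filter_forall.
Unshelve. all: by end_near. Qed.

Lemma differentiable_rV (R : numFieldType) (V : normedModType R) (n : nat)
    (f : V -> 'rV[R]_n) (x : V) :
  (forall j, differentiable (fun q => f q 0 j) x) -> differentiable f x.
Proof.
move=> fd.
rewrite (_ : f = \sum_(j < n) (fun q => f q 0 j *: delta_mx 0 j)).
  apply: differentiable_sum => j; exact: differentiableZl.
by rewrite funeqE => q; rewrite fct_sumE {1}[f q]row_sum_delta.
Qed.

Lemma JacobianE (R : realType) (m n : nat) (f : 'rV[R]_m -> 'rV[R]_n)
    (p : 'rV[R]_m) i j : differentiable f p ->
  'J f p i j = 'd (fun q => f q 0 j : R) p (delta_mx 0 i).
Proof.
move=> fd.
(* The coordinate is packed as a continuous linear map, so that it is its own differential in the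
   chain rule. *)
pose c (N : 'rV[R]_n) : R := N 0 j.
have lc : linear c by move=> k u v; rewrite /c !mxE.
pose lcM := GRing.isLinear.Build _ _ _ _ _ lc.
pose C : {linear 'rV[R]_n -> R} := HB.pack c lcM.
have Cc : continuous C by exact: coord_continuous.
rewrite -[X in 'd X p]/(C \o f) diff_comp//; last exact: linear_differentiable.
by rewrite (diff_lin _ Cc) /= /jacobian mxE.
Qed.

(** * Lipschitz inverses and perturbations of the identity *)

Lemma is_diff_lipschitz_inverse (R : numFieldType) (V W : normedModType R)
    (f : V -> W) (g : W -> V) (L : {linear W -> V}) (k : R) (w : W) :
  cancel g f -> 0 < k -> (forall x y, `|g x - g y| <= k * `|x - y|) ->
  differentiable f (g w) -> continuous L -> cancel ('d f (g w)) L ->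
  is_diff w g L.
Proof.
move=> gK k0 glip df Lc dfK.
(* Put [v = g (h + w) - g w] and let A be the differential of [f] at [g w]. Then
   [h = f (v + g w) - f (g w)] is A v + o(v). Since [L] inverts A on the left, v - L h = - L (h - A
   v) = o(v), which is o(h) because |v| <= k |h|. *)
have Lo : g \o shift w = cst (g w) + L +o_ 0 id.
  apply/eqaddoP => _/posnumP[e].
  have [C C0 LC] := linear_lipschitz Lc.
  have /diff_locally/eqaddoP/= := df.
  have Ck0 : 0 < C * k by exact: mulr_gt0.
  (* The tolerance loses a factor [C] through [L] and a factor [k] in passing from |v| to |h|, which
     leaves exactly [e]. *)
  move=> /(_ (e%:num / (C * k)) (divr_gt0 (gt0 e) Ck0)) /nbhs_ballP[d /= d0 fo].
  near=> h.
  pose v := g (h + w) - g w.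
  have vk : `|v| <= k * `|h| by rewrite (le_trans (glip _ _))// addrK.
  have hE : h = f (v + g w) - f (g w) by rewrite subrK !gK addrK.
  have fvE : (f \o shift (g w) - (cst (f (g w)) + 'd f (g w))) v =
      h - 'd f (g w) v.
    by rewrite !fctE /= opprD addrA -hE.
  have /fo : ball 0 d v.
    rewrite -ball_normE/= sub0r normrN (le_lt_trans vk)// -ltr_pdivlMl//.
    near: h; apply: nbhs0_lt; rewrite mulr_gt0// invr_gt0//.
  rewrite /= fvE => ho.
  have -> : (g \o shift w - (cst (g w) + L)) h = - L (h - 'd f (g w) v).
    by rewrite !fctE /= linearB dfK opprB opprD addrA.
  rewrite normrN (le_trans (LC _))//.
  rewrite (le_trans (ler_wpM2l (ltW C0) ho))//.
  rewrite (le_trans (ler_wpM2l (ltW C0) (ler_wpM2l _ vk)))//.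
    by rewrite divr_ge0// ltW.
  by rewrite mulrCA [C * (_ * _)]mulrA mulrA divfK ?gt_eqF.
have dg := diff_unique Lc Lo.
by apply: DiffDef => //; apply/diff_locallyP; rewrite dg.
Unshelve. all: by end_near. Qed.

(** Solutions of [f p = w] are the fixed points of [p - f p + w], a contraction with constant
    [q]. *)
Lemma near_id_surjective (R : realType) (X : completeNormedModType R)
    (f : X -> X) (q : R) : 0 <= q < 1 ->
  (forall x y, `|(x - f x) - (y - f y)| <= q * `|x - y|) ->
  forall w, exists p, f p = w.
Proof.
move=> /andP[q0 q1] fq w.
pose T := totalfun (fun p : X => p - f p + w).
have cT : is_contraction T.
  exists (NngNum q0); split => // -[x y] _ /=.
  by rewrite opprD addrACA subrr addr0.
have [|p _ pT] := banach_fixed_point cT closedT; first by exists 0.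
exists p; have /eqP : p = p - f p + w := pT.
by rewrite -addrA -subr_eq0 opprD addNKr oppr_eq0 addrC subr_eq0 => /eqP.
Qed.

(** Triangle inequality for x - y = ((x - f x) - (y - f y)) + (f x - f y). For [q < 1] it gives
    injectivity and the Lipschitz constant 1/(1 - q) of an inverse. *)
Lemma near_id_expansive (R : numDomainType) (X : normedZmodType R)
    (f : X -> X) (q : R) :
  (forall x y, `|(x - f x) - (y - f y)| <= q * `|x - y|) ->
  forall x y, (1 - q) * `|x - y| <= `|f x - f y|.
Proof.
move=> fq x y; rewrite mulrBl mul1r lerBlDl.
rewrite (le_trans _ (lerD (fq x y) (lexx _)))//.
by rewrite (le_trans _ (ler_normD _ _))// opprB addrAC !subrKA.
Qed.

Lemma continuous_det (R : numFieldType) (n : nat) :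
  continuous (fun A : 'M[R]_n => \det A : R).
Proof.
apply: continuous_big => [|s _]; first exact: add_continuous.
move=> A; apply: (@continuousM R 'M[R]_n (cst _));
  first exact: cst_continuous.
apply: continuous_big => [|i _]; first exact: mul_continuous.
exact: coord_continuous.
Qed.

(** Cramer's formula is continuous in the entries. [invmx] follows it only on invertible matrices,
    so the two are compared on a neighbourhood where the determinant stays nonzero. *)
Lemma continuous_invmx (R : numFieldType) (n : nat) (A : 'M[R]_n) :
  A \in unitmx -> {for A, continuous (fun B : 'M[R]_n => invmx B)}.
Proof.
move=> Au; have detA0 : \det A != 0 by rewrite -unitfE -unitmxE.
have nearU : \forall B \near A, B \in unitmx.
  have : \forall B \near A, \det B != 0.
    exact: (cvgr_neq0 _ (@continuous_det R n A) detA0).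
  by apply: filterS => B; rewrite unitmxE unitfE.
have adjc : {for A, continuous (fun B : 'M[R]_n => (\det B)^-1 *: \adj B)}.
  apply: continuous_mxP => i j.
  rewrite (_ : (fun _ => _) = (fun B : 'M[R]_n =>
      (\det B)^-1 * ((-1) ^+ (j + i) * \det (row' j (col' i B))))).
    apply: continuousM; first exact/continuousV/continuous_det.
    apply: (@continuousM R 'M[R]_n (cst _)); first exact: cst_continuous.
    apply: (@continuous_comp _ _ _ (fun B : 'M[R]_n => row' j (col' i B))).
      apply: continuous_mxP => k l.
      rewrite (_ : (fun _ => _) = fun B : 'M[R]_n => B (lift j k) (lift i l)).
        exact: coord_continuous.
      by apply/funext => B; rewrite !mxE.
    exact: continuous_det.
  by apply/funext => B; rewrite !mxE.
have invA : invmx A = (\det A)^-1 *: \adj A by rewrite /invmx Au.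
rewrite /prop_for /continuous_at invA.
have invE : {near A, (fun B : 'M[R]_n => (\det B)^-1 *: \adj B) =1
    (fun B => invmx B)}.
  by apply: filterS nearU => B BU; rewrite /invmx BU.
exact: cvg_trans (near_eq_cvg invE) adjc.
Qed.

Lemma continuous_mulmxr (R : numFieldType) (m n : nat) (M : 'M[R]_(m, n)) :
  continuous (fun v : 'rV[R]_m => v *m M).
Proof.
move=> v; apply: continuous_mxP => i j.
rewrite (_ : (fun _ => _) = fun v : 'rV[R]_m => \sum_k v i k * M k j);
  last first.
  by apply/funext => u; rewrite mxE.
apply: continuous_big v => [|k _]; first exact: add_continuous.
move=> u; apply: (@continuousM R 'rV[R]_m _ (cst _)).
  exact: coord_continuous.
exact: cst_continuous.
Qed.

(** The differential of [g] at [w] is right multiplication by the inverse of ['J f (g w)]. Hence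
    [Dmat g] is the composite of [g], [Dmat f] and matrix inversion, each continuous where it is
    applied. *)
Lemma C1_on_lipschitz_inverse (R : realType) (f g : 'rV[R]_2 -> 'rV[R]_2)
    (k : R) :
  C1_on setT f -> cancel g f -> 0 < k ->
  (forall x y, `|g x - g y| <= k * `|x - y|) ->
  (forall p, 'J f p \in unitmx) -> C1_on setT g.
Proof.
move=> [_ df cf] gK k0 glip fu.
pose L w : {linear 'rV[R]_2 -> 'rV[R]_2} := mulmxr (invmx ('J f (g w))).
have dg w : is_diff w g (L w).
  have dfw := df (g w) I.
  have Lc : continuous (L w) by exact: continuous_mulmxr.
  have dfK : cancel ('d f (g w)) (L w).
    by move=> v; rewrite /= -deriveE// deriveEjacobian// mulmxK.
  exact: is_diff_lipschitz_inverse gK k0 glip dfw Lc dfK.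
have gd w : differentiable g w by have [] := dg w.
split; [exact: openT|by move=> w _; exact: gd|move=> w _].
have -> : Dmat g = fun w => (invmx (Dmat f (g w))).
  rewrite funeqE => p; rewrite /Dmat -trmx_inv; congr trmx.
  apply/row_matrixP => i; rewrite !rowE -deriveEjacobian// deriveE//.
  by have [_ ->] := dg p.
apply: (@continuous_comp _ _ _ (fun w => Dmat f (g w))).
  apply: continuous_comp; last exact: cf.
  exact: differentiable_continuous.
by apply: continuous_invmx; rewrite unitmx_tr.
Qed.

(** The projection takes its values in the kernel, which is trivial here. *)
Lemma perp_proj_unit (R : realType) (A : 'M[R]_2) :
  A \in unitmx -> perp_proj A = 0.
Proof.
move=> Au; have kA0 : kermx A = 0 by apply/eqP; rewrite kermx_eq0 row_free_unit.
have := proj_mx_sub (kermx A) (kermx (kermx A)^T) 1%:M.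
by rewrite mul1mx /perp_proj kA0 submx0 => /eqP ->; rewrite trmx0.
Qed.

(** * Trigonometric bounds, the sup norm and functions of one coordinate *)

Lemma cos_sin_bounds (R : realType) (c t : R) : c <= pi / 2 -> `|t| <= c ->
  cos c <= cos t /\ `|sin t| <= sin c.
Proof.
move=> cpi tc; have pi0 := pi_ge0 R; have t0 := normr_ge0 t.
have cosct : cos c <= cos t.
  have -> : cos t = cos `|t| by case: (ger0P t) => // _; rewrite cosN.
  have [<-//|tc'] := eqVneq `|t| c.
  by rewrite ltW// ltr_cos ?in_itv/= ?lt_neqAle ?tc' ?tc//; lra.
split=> //; have s0 : 0 <= sin c by apply: sin_ge0_pi; lra.
have c0 : 0 <= cos c by apply: cos_ge0_pihalf; lra.
(* The bound on the sine follows from the one on the cosine by comparing squares through cos^2 +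
   sin^2 = 1. *)
rewrite -(ger0_norm s0) -ler_sqr ?nnegrE// !real_normK ?num_real//.
have := cos2Dsin2 t; have := cos2Dsin2 c.
have : cos c ^+ 2 <= cos t ^+ 2 by rewrite ler_sqr ?nnegrE//; lra.
lra.
Qed.

(** sin c = cos (pi/2 - c), and the cosine decreases on [0, pi] while c < pi/2 - c. *)
Lemma sin_lt_cos (R : realType) (c : R) : 0 <= c < pi / 4 -> sin c < cos c.
Proof.
move=> c4; have pi0 := pi_gt0 R.
rewrite -cosBpihalf -cosN opprB ltr_cos ?in_itv/=; lra.
Qed.

Lemma ler_rV_norm (R : realType) (n : nat) (v : 'rV[R]_n) (b : R) :
  0 <= b -> (forall j, `|v 0 j| <= b) -> `|v| <= b.
Proof.
move=> b0 vb; rewrite /Num.norm/= mx_normrE.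
by apply/bigmax_leP; split=> // -[i j] _; rewrite /= ord1.
Qed.

Lemma ler_coord_norm (R : realType) (n : nat) (v : 'rV[R]_n) j :
  `|v 0 j| <= `|v|.
Proof.
rewrite [leRHS]/Num.norm/= mx_normrE.
exact: (le_bigmax _ (fun ij : 'I_1 * 'I_n => `|v ij.1 ij.2|) (0, j)).
Qed.

Lemma is_diff_comp_coord (R : realType) (phi : R -> R) (a : R) (n : nat)
    (j : 'I_n) (p : 'rV[R]_n) :
  is_derive (p 0 j) 1 phi a ->
  is_diff p (fun q : 'rV[R]_n => phi (q 0 j)) (fun h : 'rV[R]_n => h 0 j * a).
Proof.
move=> [dphi phia].
pose c (q : 'rV[R]_n) : R := q 0 j.
have lc : linear c by move=> k u v; rewrite /c !mxE.
pose lcM := GRing.isLinear.Build _ _ _ _ _ lc.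
pose C : {linear 'rV[R]_n -> R} := HB.pack c lcM.
have Cc : continuous C by exact: coord_continuous.
have dC : differentiable C p by exact: linear_differentiable.
have dphi' : differentiable phi (C p) by exact/derivable1_diffP.
apply: DiffDef; first exact: (differentiable_comp dC dphi').
rewrite -[X in 'd X p]/(phi \o C) diff_comp//.
by rewrite (diff_lin _ Cc) diff1E// funeqE => h /=; rewrite derive1E phia.
Qed.

Lemma is_diff_sum_coord (R : realType) (phi psi : R -> R) (a b : R)
    (p : 'rV[R]_2) :
  is_derive (p 0 0) 1 phi a -> is_derive (p 0 1) 1 psi b ->
  is_diff p (fun q : 'rV[R]_2 => phi (q 0 0) + psi (q 0 1))
    (fun h : 'rV[R]_2 => h 0 0 * a + h 0 1 * b).
Proof.
move=> /is_diff_comp_coord dphi /is_diff_comp_coord dpsi.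
exact: is_diffD.
Qed.

Lemma lift_ord0_ord0 : lift ord0 ord0 = 1 :> 'I_2.
Proof. exact: val_inj. Qed.

Lemma det_mx22 (S : comNzRingType) (A : 'M[S]_2) :
  \det A = A 0 0 * A 1 1 - A 0 1 * A 1 0.
Proof.
rewrite (expand_det_row _ 0) !big_ord_recl big_ord0 /cofactor !det_mx11 !mxE.
rewrite /= lift_ord0_ord0 (_ : lift 1 0 = 0 :> 'I_2); last exact: val_inj.
by rewrite expr0 mul1r expr1 mulN1r mulrN addr0.
Qed.

Lemma ord2_ind (P : 'I_2 -> Prop) : P 0 -> P 1 -> forall i, P i.
Proof.
move=> P0 P1 [[|[|//]] i2].
- by rewrite (_ : Ordinal i2 = 0) //; exact: val_inj.
- by rewrite (_ : Ordinal i2 = 1) //; exact: val_inj.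
Qed.

(** * The map u: derivatives, invertibility and the system *)

Section u_of.
Context {R : realType} (K : R -> R) (K_cont : continuous K).
Let F := oriented_integral (fun t => cos (K t)) 0.
Let G := oriented_integral (fun t => sin (K t)) 0.

Lemma u_ofE (p : 'rV[R]_2) :
  u_of K p = \row_j (if j == 0 then F (p 0 0) - G (p 0 1)
                     else G (p 0 0) + F (p 0 1)).
Proof. by apply/rowP => j; rewrite !mxE /= !mul0r !mul1r sub0r add0r. Qed.

Lemma is_derive_int_cos (x : R) : is_derive x 1 F (cos (K x)).
Proof.
apply: is_derive_oriented_integral => t.
by apply: continuous_comp; [exact: K_cont|exact: continuous_cos].
Qed.

Lemma is_derive_int_sin (x : R) : is_derive x 1 G (sin (K x)).
Proof.
apply: is_derive_oriented_integral => t.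
by apply: continuous_comp; [exact: K_cont|exact: continuous_sin].
Qed.

Lemma is_diff_u_of0 (p : 'rV[R]_2) :
  is_diff p (fun q => u_of K q 0 0 : R)
    (fun h : 'rV[R]_2 => h 0 0 * cos (K (p 0 0)) + h 0 1 * - sin (K (p 0 1))).
Proof.
have -> : (fun q => u_of K q 0 0 : R) =
    fun q : 'rV[R]_2 => F (q 0 0) + (- G) (q 0 1).
  by apply/funext => q; rewrite u_ofE mxE.
apply: is_diff_sum_coord; first exact: is_derive_int_cos.
by apply: is_deriveN; exact: is_derive_int_sin.
Qed.

Lemma is_diff_u_of1 (p : 'rV[R]_2) :
  is_diff p (fun q => u_of K q 0 1 : R)
    (fun h : 'rV[R]_2 => h 0 0 * sin (K (p 0 0)) + h 0 1 * cos (K (p 0 1))).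
Proof.
have -> : (fun q => u_of K q 0 1 : R) =
    fun q : 'rV[R]_2 => G (q 0 0) + F (q 0 1).
  by apply/funext => q; rewrite u_ofE mxE.
apply: is_diff_sum_coord; first exact: is_derive_int_sin.
exact: is_derive_int_cos.
Qed.

Lemma differentiable_u_of (p : 'rV[R]_2) : differentiable (u_of K) p.
Proof.
apply: differentiable_rV; apply: ord2_ind.
  by have [] := is_diff_u_of0 p.
by have [] := is_diff_u_of1 p.
Qed.

Lemma Dmat_u_ofE (p : 'rV[R]_2) :
  [/\ Dmat (u_of K) p 0 0 = cos (K (p 0 0)),
      Dmat (u_of K) p 0 1 = - sin (K (p 0 1)),
      Dmat (u_of K) p 1 0 = sin (K (p 0 0)) &
      Dmat (u_of K) p 1 1 = cos (K (p 0 1))].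
Proof.
have du := differentiable_u_of p.
have [_ d0] := is_diff_u_of0 p; have [_ d1] := is_diff_u_of1 p.
rewrite /Dmat; split; rewrite mxE JacobianE// ?d0 ?d1 !mxE /=;
  by rewrite !(mul0r, mul1r, addr0, add0r).
Qed.

Lemma continuous_Dmat_u_of : continuous (Dmat (u_of K)).
Proof.
have Kc j : continuous (fun q : 'rV[R]_2 => K (q 0 j)).
  by move=> q; apply: continuous_comp; [exact: coord_continuous|exact: K_cont].
have cc j : continuous (fun q : 'rV[R]_2 => cos (K (q 0 j))).
  by move=> q; apply: continuous_comp; [exact: Kc|exact: continuous_cos].
have sc j : continuous (fun q : 'rV[R]_2 => sin (K (q 0 j))).
  by move=> q; apply: continuous_comp; [exact: Kc|exact: continuous_sin].
have eqD := Dmat_u_ofE.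
move=> p; apply: continuous_mxP; apply: ord2_ind; apply: ord2_ind.
- rewrite (_ : (fun _ => _) = fun q : 'rV[R]_2 => cos (K (q 0 0))).
    exact: cc.
  by apply/funext => q; have [-> _ _ _] := eqD q.
- rewrite (_ : (fun _ => _) = - (fun q : 'rV[R]_2 => sin (K (q 0 1)))).
    by apply: continuousN; exact: sc.
  by apply/funext => q; have [_ -> _ _] := eqD q.
- rewrite (_ : (fun _ => _) = fun q : 'rV[R]_2 => sin (K (q 0 0))).
    exact: sc.
  by apply/funext => q; have [_ _ -> _] := eqD q.
- rewrite (_ : (fun _ => _) = fun q : 'rV[R]_2 => cos (K (q 0 1))).
    exact: cc.
  by apply/funext => q; have [_ _ _ ->] := eqD q.
Qed.

Lemma C1_on_u_of : C1_on setT (u_of K).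
Proof.
split; first exact: openT.
  by move=> p _; exact: differentiable_u_of.
by move=> p _; exact: continuous_Dmat_u_of.
Qed.

Lemma sqr_frob_Dmat_u_of (p : 'rV[R]_2) : frob (Dmat (u_of K) p) ^+ 2 = 2.
Proof.
rewrite sqr_sqrtr; last by do 2 apply: sumr_ge0 => ? _; exact: sqr_ge0.
have [D00 D01 D10 D11] := Dmat_u_ofE p.
rewrite !big_ord_recl !big_ord0 /= !addr0 lift_ord0_ord0.
rewrite D00 D01 D10 D11 sqrrN.
by rewrite addrACA cos2Dsin2 [X in _ + X]addrC cos2Dsin2.
Qed.

Lemma det_Dmat_u_of (p : 'rV[R]_2) :
  \det (Dmat (u_of K) p) = cos (K (p 0 0) - K (p 0 1)).
Proof.
have [D00 D01 D10 D11] := Dmat_u_ofE p.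
by rewrite det_mx22 D00 D01 D10 D11 cosB mulNr opprK [sin _ * _]mulrC.
Qed.

(** The components of id - u are (x - F x) + G y and (y - F y) - G x. The derivative 1 - cos K of id
    - F lies in [0, 1 - cos c] and that of G is at most sin c in absolute value; in the sup norm the
    two constants add up. *)
Lemma u_of_near_id c : 0 <= c -> c <= pi / 2 -> (forall t, `|K t| <= c) ->
  forall p q, `|(p - u_of K p) - (q - u_of K q)| <=
              (1 - cos c + sin c) * `|p - q|.
Proof.
move=> c0 c2 Kc p q.
have cs t := cos_sin_bounds c2 (Kc t).
have id_F x y : `|(x - F x) - (y - F y)| <= (1 - cos c) * `|x - y|.
  apply: (@bounded_derivative_lipschitz R (id - F) (fun x => 1 - cos (K x))).
    by move=> t; apply: is_deriveB; exact: is_derive_int_cos.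
  move=> t; have [ct _] := cs t.
  by rewrite ger0_norm ?lerB// subr_ge0 cos_le1.
have G_lip x y : `|G x - G y| <= sin c * `|x - y|.
  apply: (@bounded_derivative_lipschitz R G (fun x => sin (K x))).
    exact: is_derive_int_sin.
  by move=> t; have [] := cs t.
have q1 : 0 <= 1 - cos c by rewrite subr_ge0 cos_le1.
have s0 : 0 <= sin c by have [_] := cs 0; exact: le_trans.
have pq i : `|p 0 i - q 0 i| <= `|p - q|.
  by have := ler_coord_norm (p - q) i; rewrite !mxE.
have combine (a b : R) i j : `|a| <= (1 - cos c) * `|p 0 i - q 0 i| ->
    `|b| <= sin c * `|p 0 j - q 0 j| ->
    `|a + b| <= (1 - cos c + sin c) * `|p - q|.
  move=> al bl; rewrite (le_trans (ler_normD _ _))// mulrDl lerD//.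
    by rewrite (le_trans al)// ler_wpM2l.
  by rewrite (le_trans bl)// ler_wpM2l.
apply: ler_rV_norm; first by rewrite mulr_ge0// addr_ge0.
apply: ord2_ind; rewrite !u_ofE !mxE /=.
- have := combine _ _ 0 1 (id_F (p 0 0) (q 0 0)) (G_lip (p 0 1) (q 0 1)).
  by congr (`|_| <= _); ring.
(* [G] enters the second component with a minus sign, hence the exchanged arguments. *)
- have Gl := G_lip (q 0 0) (p 0 0); rewrite (distrC (q 0 0)) in Gl.
  have := combine _ _ 1 0 (id_F (p 0 1) (q 0 1)) Gl.
  by congr (`|_| <= _); ring.
Qed.

(** |K x - K y| <= 2c < pi/2, so the cosine that equals the determinant is positive. *)
Lemma Jacobian_u_of_unit c : c < pi / 4 -> (forall t, `|K t| <= c) ->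
  forall p, 'J (u_of K) p \in unitmx.
Proof.
move=> c4 Kc p; rewrite -unitmx_tr unitmxE unitfE det_Dmat_u_of gt_eqF//.
apply: cos_gt0_pihalf.
have := Kc (p 0 0); have := Kc (p 0 1); rewrite !ler_norml.
by move=> /andP[? ?] /andP[? ?]; apply/andP; split; lra.
Qed.

Lemma C1_local_diffeo_u_of c : 0 <= c < pi / 4 -> (forall t, `|K t| <= c) ->
  C1_local_diffeo (u_of K).
Proof.
move=> c04 Kc; have /andP[c0 c4] := c04.
have pi0 := pi_gt0 R.
have c2 : c <= pi / 2 by lra.
have fq := u_of_near_id c0 c2 Kc.
set q := 1 - cos c + sin c in fq.
have q1 : q < 1 by have := sin_lt_cos c04; rewrite /q; lra.
have q0 : 0 <= q.
  by rewrite addr_ge0 ?subr_ge0 ?cos_le1// sin_ge0_pi//; lra.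
have q01 : 0 <= q < 1 by rewrite q0.
(* The library registers no join of the normed and complete structures. *)
pose rV2 : completeNormedModType R :=
  HB.pack 'rV[R]_2 (NormedModule.on 'rV[R]_2) (Complete.on 'rV[R]_2).
have [g gK] := choice (near_id_surjective (X := rV2) q01 fq).
have uexp := near_id_expansive (X := 'rV[R]_2) fq.
have q1' : 0 < 1 - q by rewrite subr_gt0.
(* [g] was chosen as a right inverse; expansiveness makes it a left inverse too, and Lipschitz. *)
have uK : cancel (u_of K) g.
  move=> p; apply/eqP; rewrite -subr_eq0 -normr_le0.
  by rewrite -(pmulr_rle0 _ q1') (le_trans (uexp _ _))// gK subrr normr0.
have glip x y : `|g x - g y| <= (1 - q)^-1 * `|x - y|.
  by rewrite ler_pdivlMl// (le_trans (uexp _ _))// !gK.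
(* The inverse is global, so the whole plane serves as both neighbourhoods at every point. *)
move=> p; exists setT, setT, g; split.
- by [].
- by apply/seteqP; split=> // w _; exists (g w).
- by move=> r _; exact: uK.
- exact: C1_on_u_of.
- apply: (C1_on_lipschitz_inverse C1_on_u_of gK _ glip).
    by rewrite invr_gt0.
  exact: Jacobian_u_of_unit c4 Kc.
Qed.

Lemma everywhere_solution_u_of c : c < pi / 4 -> (forall t, `|K t| <= c) ->
  everywhere_solution (u_of K).
Proof.
move=> c4 Kc.
have coef0 p : perp_coef (u_of K) p = 0.
  rewrite /perp_coef perp_proj_unit ?scaler0// unitmx_tr.
  exact: Jacobian_u_of_unit c4 Kc p.
have h1 : half_sqnorm_D (u_of K) = cst 1.
  apply/funext => p; rewrite /half_sqnorm_D sqr_frob_Dmat_u_of.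
  by rewrite mulVf.
split.
- exact: differentiable_u_of.
- by move=> p; rewrite h1; exact: differentiable_cst.
(* The premise contradicts [coef0], so no second derivative of u, which may fail to exist for a
   merely continuous [K], has to be produced. *)
- by [].
- move=> p; rewrite /perp_term asboolT// addr0.
  rewrite (_ : grad _ _ = 0) ?mulmx0//.
  by apply/colP => i; rewrite !mxE h1 derive_cst.
Qed.
End u_of.

(** The extended supremum lies between 0 and a real number, hence is finite; its real value is the
    witness [c]. *)
Lemma sup_norm_bound (R : realType) (K : R -> R) (b : R) :
  (ereal_sup [set (`|K t|)%:E | t in [set: R]] < b%:E)%E ->
  exists2 c, 0 <= c < b & forall t, `|K t| <= c.
Proof.
set S := ereal_sup _ => Sb.
have KS t : ((`|K t|)%:E <= S)%E by apply: ereal_sup_ubound; exists t.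
have S0 : (0 <= S)%E by apply: le_trans (KS 0); rewrite lee_fin.
have Sfin : S \is a fin_num by rewrite ge0_fin_numE// (lt_trans Sb)// ltry.
exists (fine S).
  by rewrite -lee_fin -lte_fin fineK// S0.
by move=> t; rewrite -lee_fin fineK.
Qed.

Unset Implicit Arguments.

Theorem proposition6p1 (R : realType) (K : R -> R)
  (K_cont : continuous K)
  (K_bound : (ereal_sup [set (`|K t|)%:E | t in [set: R]] < (pi / 4)%:E)%E) :
  [/\ C1_on [set: 'rV[R]_2] (u_of K),
      C1_local_diffeo (u_of K)
    & everywhere_solution (u_of K)].
Proof.
have [c c04 Kc] := sup_norm_bound K_bound.
have /andP[_ c4] := c04.
split.
- exact: C1_on_u_of.
- exact: C1_local_diffeo_u_of c04 Kc.
- exact: everywhere_solution_u_of c4 Kc.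
Qed.
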